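(* Let $A\subseteq\mathbb{Z}^2$ be a set with $d^*(A)>0$. Then there exists $B\subseteq\mathbb{Z}$ such that $\overline{d}_{\log}(B)\geq d^*(A)^2$ and $B\times B\subseteq A-A$.
   Context: For $A\subseteq\mathbb{Z}^2$, the upper Banach density is $d^*(A)=\sup_{(R_N)}\limsup_{N\to\infty}\frac{|A\cap R_N|}{|R_N|}$, where $(R_N)$ ranges over all sequences of rectangles $R_N=([a_N,b_N]\times[c_N,d_N])\cap\mathbb{Z}^2$ such that $\lim_{N}(b_N-a_N)=\lim_N(d_N-c_N)=\infty$. The upper logarithmic density is $\overline{d}_{\log}(B)=\limsup_{N\to\infty}\frac{1}{\log N}\sum_{n=1}^N\frac{1_B(n)}{n}$, where $1_B$ is the indicator function of $B$ (for $B\subseteq\mathbb{Z}$ only the positive elements of $B$ matter). $A-A=\{x-y:x,y\in A\}\subseteq\mathbb{Z}^2$. *)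

(* Defs.v *)
From mathcomp Require Import all_boot all_order all_algebra.
From mathcomp Require Import finmap.
From mathcomp Require Import all_classical all_reals all_analysis.

Set Implicit Arguments.
Unset Strict Implicit.
Unset Printing Implicit Defensive.

Import Order.TTheory GRing.Theory Num.Theory.
Import numFieldNormedType.Exports.

Local Open Scope classical_set_scope.
Local Open Scope ring_scope.

Definition lattice_rect (a b c d : int) : set (int * int) :=
  `[a, b]%classic `*` `[c, d]%classic.

(* [fset_set X] is only meaningful for finite [X]; below [X] is always contained
   in a rectangle. *)
Definition set_card (T : choiceType) (X : set T) : nat := #|` fset_set X|%fset.

(* The quotient is 0 when the rectangle is empty, which can only happen for
   finitely many terms of an admissible sequence. *)
Definition rel_density (R : realType) (A Q : set (int * int)) : R :=
  (set_card (A `&` Q))%:R / (set_card Q)%:R.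

Definition admissible_rects (R : realType) (Q : nat -> set (int * int)) : Prop :=
  exists a b c d : nat -> int,
    [/\ forall N, Q N = lattice_rect (a N) (b N) (c N) (d N),
        (b N - a N)%:~R @[N --> \oo] --> (+oo : set_system R)
      & (d N - c N)%:~R @[N --> \oo] --> (+oo : set_system R)].

Definition upper_banach_density (R : realType) (A : set (int * int)) : \bar R :=
  ereal_sup [set limn_esup (fun N => (rel_density R A (Q N))%:E)
            | Q in admissible_rects R].

(* [\1_B n%:Z] only tests positive elements of [B]. *)
Definition upper_log_density (R : realType) (B : set int) : \bar R :=
  limn_esup (fun N : nat =>
    ((ln (N%:R : R))^-1 * \sum_(1 <= n < N.+1) \1_B n%:Z / n%:R)%:E).

Definition difference_set (V : zmodType) (A : set V) : set V :=
  [set x - y | x in A & y in A].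

(* Main.v *)
Require Import Defs.
From mathcomp Require Import all_boot all_order all_algebra.
From mathcomp Require Import all_classical all_reals all_analysis.
From mathcomp Require Import ring lra zify.

Set Implicit Arguments.
Unset Strict Implicit.
Unset Printing Implicit Defensive.

Import Order.TTheory GRing.Theory Num.Theory.
Import numFieldNormedType.Exports.

Local Open Scope classical_set_scope.

(** For a point [x] of Z^2 let [B_x] be the set of the [n] such that
    [x + (n, 0)] and [x - (0, n)] both lie in [A].  If [b] and [b'] are in
    [B_x], then [(b, b')] is the difference of the points [x + (b, 0)] and
    [x - (0, b')] of [A]; hence [B_x `*` B_x] is contained in [A - A] for every
    [x], and the problem is to find a point, or a limit of points, at which
    [B_x] is large.

    Average over [x] with a finitely additive, translation invariant mean [L]
    for which [A] has mean at least its upper Banach density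
    ([density_invariant_mean]); it is an ultrafilter limit of averages over
    large rectangles in which [A] is dense.  By invariance the mean of the
    event [n \in B_x] is the correlation [c n] of the indicator of [A] with its
    translate by [(n, n)].  Cauchy-Schwarz, applied to sums of [H] consecutive
    translates, bounds below the Fejer sums of [c] by [(L \1_A) ^+ 2] times
    [H ^+ 2], and summing by parts twice turns this into the same lower bound
    for the logarithmic averages of [c] ([log_sum_ge],
    [log_correlation_ge]).  So the logarithmic averages of [B_x] have mean
    asymptotically at least [beta := (L \1_A) ^+ 2].

    What remains is a form of Fatou's lemma: a single point whose upper
    logarithmic density is at least [beta], without loss of an epsilon.  For a
    finitely additive mean no point need have this property, but its finite
    approximations exist: [simultaneous_windows] fixes, once and for all,
    windows [[j, K j)] such that for every [k] some point has a logarithmic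
    average at least [beta - 2^-1 ^+ j] in each of the first [k] windows.  The
    limit of the sets [B_x] of these points along an ultrafilter is the
    required [B]: on each initial segment it coincides with some [B_x]
    ([ultra_agree]), and each pair of its elements lies in some [B_x]
    ([difference_set_limit]).

    Logarithmic averages are normalised by the harmonic number instead of
    [ln N]; this keeps them in [[0, 1]], and only makes them smaller. *)

(** * Finitely additive means *)

Section Means.
Local Open Scope ring_scope.
Variables (R : realType) (T : Type).
Implicit Types (f g : T -> R) (L : (T -> R) -> R).

Definition bdd f := exists M, forall x, `|f x| <= M.

Lemma bdd_between a b f : (forall x, a <= f x <= b) -> bdd f.
Proof.
move=> fab; exists (`|a| + `|b|) => x; rewrite ler_norml.
have /andP[af fb] := fab x.
have := ler_norm b; have := ler_norm (- a); rewrite normrN.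
have := normr_ge0 a; have := normr_ge0 b; lra.
Qed.

Lemma bdd_cst c : bdd (fun=> c).
Proof. by apply: (@bdd_between c c) => x; rewrite lexx. Qed.

Lemma bddD f g : bdd f -> bdd g -> bdd (fun x => f x + g x).
Proof.
move=> [M fM] [N gN]; exists (M + N) => x.
exact: le_trans (ler_normD _ _) (lerD (fM x) (gN x)).
Qed.

Lemma bddM f g : bdd f -> bdd g -> bdd (fun x => f x * g x).
Proof.
move=> [M fM] [N gN]; exists (M * N) => x.
by rewrite normrM ler_pM.
Qed.

Lemma bddZ c f : bdd f -> bdd (fun x => c * f x).
Proof. by apply: bddM; exact: bdd_cst. Qed.

Lemma bddB f g : bdd f -> bdd g -> bdd (fun x => f x - g x).
Proof.
move=> bf [N gN]; apply: bddD => //; exists N => x; rewrite normrN; exact: gN.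
Qed.

Lemma bdd_sum (I : Type) (r : seq I) (F : I -> T -> R) :
  (forall i, bdd (F i)) -> bdd (fun x => \sum_(i <- r) F i x).
Proof.
move=> bF; elim: r => [|i r IHr].
  by under eq_fun do rewrite big_nil; exact: bdd_cst.
by under eq_fun do rewrite big_cons; exact: bddD.
Qed.

Lemma bdd_max f g : bdd f -> bdd g -> bdd (fun x => Num.max (f x) (g x)).
Proof.
move=> [M fM] [N gN]; exists (M + N) => x.
have := fM x; have := gN x; have := normr_ge0 (f x); have := normr_ge0 (g x).
by rewrite /Num.max; case: ifP => _; lra.
Qed.

Lemma bdd_min f g : bdd f -> bdd g -> bdd (fun x => Num.min (f x) (g x)).
Proof.
move=> [M fM] [N gN]; exists (M + N) => x.
have := fM x; have := gN x; have := normr_ge0 (f x); have := normr_ge0 (g x).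
by rewrite /Num.min; case: ifP => _; lra.
Qed.

(** Finitely additive probability measures, seen as integrals; the laws are
    restricted to bounded functions because a limit of averages has no
    meaningful value elsewhere. *)
Record is_mean L : Prop := IsMean {
  meanD : forall f g, bdd f -> bdd g -> L (fun x => f x + g x) = L f + L g;
  meanZ : forall c f, bdd f -> L (fun x => c * f x) = c * L f;
  mean_le : forall f g, bdd f -> bdd g -> (forall x, f x <= g x) -> L f <= L g;
  mean1 : L (fun=> 1) = 1 }.

Section MeanTheory.
Variables (L : (T -> R) -> R) (Lm : is_mean L).

Lemma mean_cst c : L (fun=> c) = c.
Proof.
have -> : (fun=> c) = (fun _ : T => c * 1) by apply: funext => x; rewrite mulr1.
by rewrite (meanZ Lm) ?(mean1 Lm) ?mulr1//; exact: bdd_cst.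
Qed.

Lemma meanB f g : bdd f -> bdd g -> L (fun x => f x - g x) = L f - L g.
Proof.
move=> bf bg; under eq_fun do rewrite -mulN1r.
by rewrite (meanD Lm) ?(meanZ Lm) ?mulN1r//; exact: bddZ.
Qed.

Lemma mean_sum (I : Type) (r : seq I) (F : I -> T -> R) :
  (forall i, bdd (F i)) ->
  L (fun x => \sum_(i <- r) F i x) = \sum_(i <- r) L (F i).
Proof.
move=> bF; elim: r => [|i r IHr].
  by under eq_fun do rewrite big_nil; rewrite big_nil mean_cst.
under eq_fun do rewrite big_cons.
by rewrite (meanD Lm) ?big_cons ?IHr//; exact: bdd_sum.
Qed.

(** Together with a bound on the mean of the maximum, this bounds the mean of a
    minimum from below. *)
Lemma mean_max_min f g : bdd f -> bdd g ->
  L (fun x => Num.max (f x) (g x)) + L (fun x => Num.min (f x) (g x)) =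
  L f + L g.
Proof.
move=> bf bg; rewrite -(meanD Lm (bdd_max bf bg) (bdd_min bf bg)).
by under eq_fun do rewrite addr_max_min; rewrite (meanD Lm).
Qed.

(** Cauchy-Schwarz against the constant function: expand
    [0 <= L ((f - L f) ^+ 2)]. *)
Lemma mean_sqr_ge f : bdd f -> L f ^+ 2 <= L (fun x => f x ^+ 2).
Proof.
move=> bf; set a := L f.
have bf2 : bdd (fun x => f x ^+ 2) by under eq_fun do rewrite expr2; exact: bddM.
have bf1 : bdd (fun x => (2 * a) * f x) by exact: bddZ.
have : L (fun x => (2 * a) * f x - a ^+ 2) <= L (fun x => f x ^+ 2).
  apply: (mean_le Lm) => //; first by apply: bddB => //; exact: bdd_cst.
  by move=> x; have := sqr_ge0 (f x - a); rewrite !expr2; nra.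
rewrite meanB//; last exact: bdd_cst.
by rewrite (meanZ Lm) // mean_cst -/a !expr2; nra.
Qed.

Lemma mean_lt_exists f c : bdd f -> L f < c -> exists x, f x < c.
Proof.
move=> bf Lfc; apply: contrapT => nx; move: Lfc; apply/negP; rewrite -leNgt.
rewrite -[leLHS]mean_cst; apply: mean_le => //; first exact: bdd_cst.
by move=> x; rewrite leNgt; apply/negP => fx; apply: nx; exists x.
Qed.

End MeanTheory.
End Means.

(** * A finitary Fatou lemma *)

Section Fatou.
Local Open Scope ring_scope.
Variables (R : realType) (T : Type) (L : (T -> R) -> R).
Hypothesis Lm : is_mean L.
Variable g : nat -> T -> R.
Hypothesis g01 : forall N x, 0 <= g N x <= 1.

Let h m M x : R := \big[Num.max/0]_(m <= N < M) g N x.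

Let h01 m M x : 0 <= h m M x <= 1.
Proof.
rewrite /h; elim/big_ind: _ => [|a b|N _]; rewrite ?lexx ?ler01//.
by rewrite /Num.max; case: ifP.
Qed.

Let bdd_h m M : bdd (h m M).
Proof. by apply: (@bdd_between _ _ 0 1) => x; exact: h01. Qed.

Let h_ge m M N x : (m <= N < M)%N -> g N x <= h m M x.
Proof. by move=> mNM; apply: le_bigmax_seq; rewrite ?mem_index_iota. Qed.

Let h_mono m M m' M' x : (m' <= m)%N -> (M <= M')%N -> h m M x <= h m' M' x.
Proof. exact: le_bigmax_nat. Qed.

Let h_attained m M x c : (m < M)%N -> c <= h m M x ->
  exists2 N, (m <= N < M)%N & c <= g N x.
Proof.
move=> mM; rewrite /h big_nat => ch.
have [h0|[N mNM hN]] : h m M x = 0 \/ exists2 N, (m <= N < M)%N & h m M x = g N x.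
    rewrite /h big_nat; elim/big_ind: _ => [|a b|N mNM]; first by left.
      by rewrite /Num.max; case: ifP.
    by right; exists N.
  exists m; first by rewrite leqnn.
  rewrite /h big_nat in h0; rewrite (le_trans ch)// h0.
  by have /andP[] := g01 m x.
by exists N => //; rewrite -hN /h big_nat.
Qed.

(* The error allowed at the j-th window is a difference of consecutive terms of
   [d], so that the errors of the windows from [J] on add up to at most [d J]. *)
Let d j : R := 4^-1 ^+ j.+1.

Variable beta : R.
Hypothesis g_ge : forall e j, 0 < e -> exists2 N, (j <= N)%N & beta - e <= L (g N).

Let s j := sup [set L (h j M) | M in setT].

Let s_has_sup j : has_sup [set L (h j M) | M in setT].
Proof.
split; first by exists (L (h j 0)), 0%N.
exists 1 => _ [M _ <-]; rewrite -(mean_cst Lm 1).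
apply: (mean_le Lm) => //; first exact: bdd_cst.
by move=> x; have /andP[] := h01 j M x.
Qed.

Let s_ge j M : L (h j M) <= s j.
Proof. by apply: (sup_upper_bound (s_has_sup j)); exists M. Qed.

Let bdd_g N : bdd (g N).
Proof. exact: (@bdd_between _ _ 0 1). Qed.

Let s_beta j : beta <= s j.
Proof.
apply/ler_addgt0Pr => e e0; have [N jN gN] := g_ge j e0.
suff : L (g N) <= s j by lra.
apply: le_trans (s_ge j N.+1); apply: (mean_le Lm) => // x.
by apply: h_ge; rewrite jN ltnS leqnn.
Qed.

Let win_exists j : {M | (j < M)%N /\ s j - (d j - d j.+1) <= L (h j M)}.
Proof.
apply: cid; have d0 : 0 < d j - d j.+1.
  have : 0 < d j by rewrite exprn_gt0// invr_gt0.
  by rewrite [d j.+1]exprS -/(d j); lra.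
have [_ [M _ <-] sM] := sup_adherent d0 (s_has_sup j).
exists (maxn M j.+1); split; first by rewrite leq_maxr.
apply: (le_trans (ltW sM)); apply: (mean_le Lm) => // x.
by apply: h_mono; rewrite ?leq_maxl.
Qed.

Let W j := projT1 (win_exists j).
Let w j x := h j (W j) x.
(* The minimum of the [w j x] for [J <= j < k]; the value 1 of the empty minimum
   is harmless since [w j x <= 1]. *)
Let r J k x : R := iteri (k - J) (fun i a => Num.min a (w (J + i) x)) 1.

Let w01 j x : 0 <= w j x <= 1. Proof. exact: h01. Qed.

Let rS J k x : (J <= k)%N -> r J k.+1 x = Num.min (r J k x) (w k x).
Proof. by move=> Jk; rewrite /r subSn//= subnKC. Qed.

Let r01 J k x : 0 <= r J k x <= 1.
Proof.
rewrite /r; elim: (k - J)%N => [|i] /=; first by rewrite lexx ler01.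
by rewrite /Num.min; case: ifP.
Qed.

Let bdd_w j : bdd (w j).
Proof. exact: (@bdd_between _ _ 0 1). Qed.

Let bdd_r J k : bdd (r J k).
Proof. exact: (@bdd_between _ _ 0 1). Qed.

Let r_le J k j x : (J <= j < k)%N -> r J k x <= w j x.
Proof.
move=> /andP[Jj]; elim: k => // k IHk; rewrite ltnS leq_eqVlt => /predU1P[jk|jk].
  by rewrite rS -jk// ge_min lexx orbT.
by rewrite rS ?ge_min ?IHk// (leq_trans Jj)// ltnW.
Qed.

(* Minima of window maxima have large mean.  The maximum of [r J k.+1] and
   [w k.+1] is below the maximum of [g] over a window starting at [k], so its
   mean is at most [s k]; hence adjoining the window [k.+1] lowers the mean of
   the minimum by at most [s k - s k.+1] and the error of that window, and the
   differences of [s] telescope. *)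
Let mean_r J n : s (J + n)%N - (d J - d (J + n).+1) <= L (r J (J + n).+1).
Proof.
have [Ww Hw] : (forall j, (j < W j)%N) /\
    (forall j, s j - (d j - d j.+1) <= L (w j)).
  by split=> j; have [] := projT2 (win_exists j).
elim: n => [|n IHn].
  rewrite addn0; have -> : r J J.+1 = w J; last exact: Hw.
  apply: funext => x; rewrite rS// /r subnn; apply/min_idPr.
  by have /andP[] := w01 J x.
rewrite addnS; set k := (J + n)%N in IHn *.
have -> : r J k.+2 = (fun x => Num.min (r J k.+1 x) (w k.+1 x)).
  by apply: funext => x; rewrite rS// ltnW// ltnS leq_addr.
have := mean_max_min Lm (bdd_r J k.+1) (bdd_w k.+1).
have : L (fun x => Num.max (r J k.+1 x) (w k.+1 x)) <= s k.
  apply: le_trans (s_ge k (maxn (W k) (W k.+1))).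
  apply: (mean_le Lm) => //; first exact: bdd_max.
  move=> x; rewrite ge_max; apply/andP; split.
    apply: (@le_trans _ _ (w k x)); first by apply: r_le; rewrite leq_addr leqnn.
    by apply: h_mono; rewrite ?leq_maxl.
  by apply: h_mono; rewrite ?leq_maxr.
have := Hw k.+1; lra.
Qed.

Let mean_r_beta J k : (J < k)%N -> beta - d J <= L (r J k).
Proof.
move=> Jk; have := mean_r J (k - J).-1; have -> : ((J + (k - J).-1).+1 = k)%N by lia.
apply: le_trans; have := s_beta (J + (k - J).-1).
have : 0 <= d k by rewrite exprn_ge0// invr_ge0.
lra.
Qed.

(** If for some [J] every minimum [r J k] takes a value [>= beta], those points
    work.  Otherwise, for each [J] some [r J k] is [< beta] everywhere; as its
    mean is at least [beta - d J], it exceeds [beta - 2^-1 ^+ J] outside an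
    exceptional set of mean at most [2 ^+ J * d J] by Markov's inequality.
    These bounds have sum less than 1, so some point avoids any given finite
    family of exceptional sets. *)
Lemma simultaneous_windows : exists K : nat -> nat, forall k, exists x,
  forall j, (j < k)%N ->
    exists2 N, (j <= N < K j)%N & beta - 2^-1 ^+ j <= g N x.
Proof.
have WJ j : (j < W j)%N by have [] := projT2 (win_exists j).
have [[J HJ]|nJ] := pselect (exists J, forall k, (J < k)%N ->
    exists x, beta <= r J k x).
  (* Only the windows from [J] on are controlled; the earlier ones are enlarged
     to contain window [J]. *)
  exists (fun j => W (maxn j J)) => k.
  have [x hx] := HJ (maxn k J).+1 (leq_maxr _ _); exists x => j jk.
  have [|N /andP[jN NW] bN] := @h_attained (maxn j J) (W (maxn j J)) x beta (WJ _).
    apply: (le_trans hx); apply: r_le; rewrite leq_maxr/= ltnS.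
    by rewrite geq_max leq_maxr andbT leq_max ltnW.
  exists N; first by rewrite NW andbT (leq_trans _ jN)// leq_maxl.
  by rewrite (le_trans _ bN)// gerBl exprn_ge0// invr_ge0.
have {}nJ J : {k | (J < k)%N /\ forall x, r J k x < beta}.
  apply: cid; apply: contrapT => nk; apply: nJ; exists J => k Jk.
  apply: contrapT => nx; apply: nk; exists k; split => // x.
  by rewrite ltNge; apply/negP => bx; apply: nx; exists x.
pose q j x := r j (projT1 (nJ j)) x.
have qb j x : q j x < beta by have [_] := projT2 (nJ j); exact.
exists W => k.
(* Markov's inequality and the union bound in one step: each [F j] is
   nonnegative, and [F j x < 1] means [q j x > beta - 2^-1 ^+ j]. *)
pose F j x := 2 ^+ j * (beta - q j x).
have bF j : bdd (F j) by apply: bddZ; apply: bddB; [exact: bdd_cst|exact: bdd_r].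
have F_ge0 j x : 0 <= F j x by rewrite mulr_ge0 ?exprn_ge0// subr_ge0 ltW.
have LF j : L (F j) <= 4^-1 * 2^-1 ^+ j.
  rewrite (meanZ Lm); last by apply: bddB; [exact: bdd_cst|exact: bdd_r].
  rewrite (meanB Lm) ?(mean_cst Lm)//; [|exact: bdd_cst|exact: bdd_r].
  have -> : 4^-1 * 2^-1 ^+ j = 2 ^+ j * d j :> R.
    rewrite /d exprS mulrCA; congr (_ * _); rewrite -exprMn; congr (_ ^+ j); lra.
  rewrite ler_pM2l ?exprn_gt0//.
  have [Jk _] := projT2 (nJ j); have := mean_r_beta Jk; rewrite /q; lra.
have [x Fx] : exists x, \sum_(0 <= j < k) F j x < 1.
  apply: (mean_lt_exists Lm); first exact: bdd_sum.
  rewrite (mean_sum Lm)//; apply: le_lt_trans (ler_sum _ (fun j _ => LF j)) _.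
  suff -> : \sum_(0 <= j < k) 4^-1 * 2^-1 ^+ j = 2^-1 - 2^-1 * 2^-1 ^+ k :> R.
    by have : 0 <= 2^-1 ^+ k :> R by [rewrite exprn_ge0// invr_ge0]; lra.
  elim: k => [|k IHk]; first by rewrite big_geq// expr0; lra.
  by rewrite big_nat_recr//= IHk exprS; lra.
exists x => j jk; apply: h_attained => //.
apply: (@le_trans _ _ (q j x)); last first.
  by have [Jk _] := projT2 (nJ j); apply: r_le; rewrite leqnn.
have : F j x < 1.
  apply: le_lt_trans Fx; rewrite (bigD1_seq j) ?mem_index_iota ?iota_uniq//=.
  by rewrite lerDl sumr_ge0.
rewrite /F => Fj; have e0 : 0 < 2 ^+ j :> R by rewrite exprn_gt0.
by rewrite exprVn lerBlDr -lerBlDl -(ler_pM2l e0) mulfV ?gt_eqF// ltW.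
Qed.

End Fatou.

(** * Logarithmic averages of correlation sequences *)

Section Harmonic.
Local Open Scope ring_scope.
Variable R : realType.

Definition harm N : R := \sum_(1 <= n < N.+1) n%:R^-1.

Lemma harmS N : harm N.+1 = harm N + N.+1%:R^-1.
Proof. by rewrite /harm big_nat_recr. Qed.

Lemma harm_ge0 N : 0 <= harm N.
Proof. by apply: sumr_ge0 => n _; rewrite invr_ge0. Qed.

Lemma harm_gt0 N : (0 < N)%N -> 0 < harm N.
Proof. by case: N => // N _; rewrite harmS ltr_wpDl ?harm_ge0// invr_gt0. Qed.

Lemma lnS_le_harm N : ln (N.+1%:R : R) <= harm N.
Proof.
elim: N => [|N IHN]; first by rewrite ln1 harm_ge0.
rewrite harmS; have -> : N.+2%:R = N.+1%:R * (1 + N.+1%:R^-1) :> R.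
  by rewrite mulrDr mulr1 mulfV// -natr1.
rewrite lnM ?posrE ?ltr_wpDl ?invr_ge0 ?ltr0n//.
apply: lerD => //; apply: le_ln1Dx.
by apply: lt_le_trans (_ : 0 <= _); rewrite ?ltrN10 ?invr_ge0.
Qed.

Lemma harm_unbounded (c : R) j : exists2 N, (j <= N)%N & c <= harm N.
Proof.
pose m := Num.bound (expR c).
exists (maxn j m); first exact: leq_maxl.
apply: le_trans (lnS_le_harm _); rewrite -ler_expR lnK ?posrE//.
apply: (@le_trans _ _ m%:R).
  by rewrite ltW// archi_boundP// expR_ge0.
by rewrite ler_nat ltnW// ltnS leq_maxr.
Qed.

(** [D] is the double sum of the [c `|h - h'|] for [h, h' < H], whose second
    differences are [2 * c].  Two summations by parts against [n^-1] leave the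
    weights [2 / (n * (n + 1) * (n + 2))] on [D n.+1], which is at least
    [beta * (n + 1) ^+ 2], and nonnegative boundary terms at the upper end; the
    constant 2 absorbs the boundary terms at the lower end. *)
Lemma log_sum_ge (c D : nat -> R) (beta : R) :
  0 <= beta -> (forall n, 0 <= c n <= 1) -> D 0%N = 0 ->
  (forall H, D H.+1 = D H + (c 0%N + 2 * \sum_(1 <= n < H.+1) c n)) ->
  (forall H, beta * H%:R ^+ 2 <= D H) ->
  forall N, beta * harm N - 2 <= \sum_(1 <= n < N.+1) c n / n%:R.
Proof.
move=> beta0 c01 D0 DS D_ge N.
pose S H := c 0%N + 2 * \sum_(1 <= n < H.+1) c n.
have S_ge0 H : 0 <= S H.
  rewrite addr_ge0 ?mulr_ge0//; last by apply: sumr_ge0 => n _; have /andP[] := c01 n.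
  by have /andP[] := c01 0%N.
have /andP[c0_ge0 c0_le1] := c01 0%N.
have D1 : D 1%N = c 0%N by rewrite DS D0 big_geq// mulr0 addr0 add0r.
have beta1 : beta <= c 0%N by have := D_ge 1%N; rewrite D1 expr1n mulr1.
(* The two fractions on the left are the boundary terms at [M]; in this form the
   estimate is inductive. *)
have key M : S M / M.+1%:R + D M.+1 / (M.+1%:R * M.+2%:R) - 3 / 2 * c 0%N
    + 2 * beta * (harm M.+1 - 1) <= 2 * \sum_(1 <= n < M.+1) c n / n%:R.
  elim: M => [|M IHM].
    rewrite /S harmS /harm !big_geq// D1; lra.
  rewrite [\sum_(1 <= n < M.+2) _]big_nat_recr//= harmS.
  have SS : S M = S M.+1 - 2 * c M.+1 by rewrite /S [\sum_(1 <= n < M.+2) _]big_nat_recr//=; ring.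
  have DD : D M.+1 = D M.+2 - S M.+1 by rewrite [D M.+2]DS /S; ring.
  move: IHM; rewrite SS DD; have := D_ge M.+2.
  have -> : M.+3%:R = M.+1%:R + 2 :> R by rewrite -natrD addn2.
  have -> : M.+2%:R = M.+1%:R + 1 :> R by rewrite natr1.
  set x := M.+1%:R; have x0 : 0 < x by rewrite ltr0n.
  move: (S M.+1) (D M.+2) (c M.+1) => s d c' dge IH.
  have hd : beta / (x + 1) <= d / (x * (x + 1) * (x + 2)).
    rewrite ler_pdivlMr ?mulr_gt0 ?addr_gt0//.
    have -> : beta / (x + 1) * (x * (x + 1) * (x + 2)) = beta * (x * (x + 2)).
      by field; rewrite gt_eqF// addr_gt0.
    by apply: le_trans dge; rewrite ler_wpM2l// expr2; nra.
  rewrite -subr_ge0 in IH; rewrite -subr_ge0.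
  (* The increments of the two sides differ exactly by twice the gap in [hd]. *)
  suff -> : 2 * (\sum_(1 <= i < M.+1) c i / i%:R + c' / x) -
      (s / (x + 1) + d / ((x + 1) * (x + 2)) - 3 / 2 * c 0%N +
       2 * beta * (harm M.+1 + (x + 1)^-1 - 1)) =
      (2 * (\sum_(1 <= i < M.+1) c i / i%:R) -
      ((s - 2 * c') / x + (d - s) / (x * (x + 1)) - 3 / 2 * c 0%N +
       2 * beta * (harm M.+1 - 1))) +
      2 * (d / (x * (x + 1) * (x + 2)) - beta / (x + 1)).
    by rewrite addr_ge0// mulr_ge0// subr_ge0.
  by field; rewrite !gt_eqF// addr_gt0.
have := key N; rewrite harmS.
have : 0 <= S N / N.+1%:R by rewrite divr_ge0.
have : 0 <= D N.+1 / (N.+1%:R * N.+2%:R).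
  by rewrite divr_ge0// (le_trans _ (D_ge _))// mulr_ge0// exprn_ge0.
have : 0 <= beta * N.+1%:R^-1 by rewrite !mulr_ge0 ?invr_ge0.
move: (D N.+1 / (N.+1%:R * N.+2%:R)) (harm N) => y h.
move: (S N / N.+1%:R) (\sum_(1 <= n < N.+1) c n / n%:R) (N.+1%:R^-1) => u t i.
nra.
Qed.

End Harmonic.

Section Correlation.
Local Open Scope ring_scope.
Variables (R : realType) (V : zmodType) (L : (V -> R) -> R).
Hypothesis Lm : is_mean L.
Hypothesis L_shift : forall v f, bdd f -> L (fun x => f (x + v)) = L f.

(** The sequence [D] of [log_sum_ge] is here the mean of the square of the sum of
    [H] consecutive translates of [phi], whose mean is [H%:R * L phi]. *)
Lemma log_correlation_ge (phi : V -> R) (u : V) :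
  (forall x, 0 <= phi x <= 1) -> forall N,
  L phi ^+ 2 * harm R N - 2 <=
    \sum_(1 <= n < N.+1) L (fun x => phi x * phi (x + u *+ n)) / n%:R.
Proof.
move=> phi01.
have bphi v : bdd (fun x => phi (x + v)) by apply: (@bdd_between _ _ 0 1).
pose c n := L (fun x => phi x * phi (x + u *+ n)).
have c_lag h H : (h <= H)%N ->
    L (fun x => phi (x + u *+ h) * phi (x + u *+ H)) = c (H - h)%N.
  move=> hH; rewrite /c -[RHS](@L_shift (u *+ h)).
    by congr L; apply: funext => x; rewrite -addrA -mulrnDr subnKC.
  by apply: bddM => //; apply: (@bdd_between _ _ 0 1).
pose s H x := \sum_(0 <= h < H) phi (x + u *+ h).
have bs H : bdd (s H) by apply: bdd_sum.
pose D H := L (fun x => s H x ^+ 2).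
apply: (@log_sum_ge _ c D).
- exact: sqr_ge0.
- move=> n; have f01 x : 0 <= phi x * phi (x + u *+ n) <= 1.
    have /andP[p0 p1] := phi01 x; have /andP[q0 q1] := phi01 (x + u *+ n).
    by rewrite mulr_ge0// mulr_ile1.
  have bf := bdd_between f01; rewrite /c -{1}(mean_cst Lm 0) -(mean_cst Lm 1).
  by apply/andP; split; apply: (mean_le Lm) => //; try exact: bdd_cst;
    move=> x; have /andP[] := f01 x.
- rewrite /D /s; under eq_fun do rewrite big_geq// expr0n.
  exact: mean_cst.
- move=> H; rewrite /D.
  have -> : (fun x => s H.+1 x ^+ 2) = (fun x => s H x ^+ 2 +
      (phi (x + u *+ H) * phi (x + u *+ H) +
       2 * \sum_(0 <= h < H) phi (x + u *+ h) * phi (x + u *+ H))).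
    apply: funext => x; rewrite /s big_nat_recr//= -mulr_suml.
    by ring.
  have bHh h : bdd (fun x => phi (x + u *+ h) * phi (x + u *+ H)) by exact: bddM.
  have bsum : bdd (fun x => \sum_(0 <= h < H) phi (x + u *+ h) * phi (x + u *+ H)).
    exact: bdd_sum.
  rewrite (meanD Lm); first last.
  + by apply: bddD => //; exact: bddZ.
  + by under eq_fun do rewrite expr2; exact: bddM.
  rewrite (meanD Lm)//; last exact: bddZ.
  rewrite (meanZ Lm)// (mean_sum Lm)// c_lag// subnn; congr (_ + (_ + 2 * _)).
  rewrite big_nat_rev big_add1/=; apply: eq_big_nat => h /andP[_ hH].
  by rewrite add0n c_lag ?leq_subr// subKn.
- move=> H; rewrite mulrC -exprMn /D; apply: le_trans (mean_sqr_ge Lm (bs H)).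
  have -> : L (s H) = H%:R * L phi; last by [].
  rewrite /s (mean_sum Lm)// (eq_bigr (fun=> L phi)) => [|h _].
    by rewrite sumr_const_nat subn0 mulr_natl.
  by rewrite L_shift//; exact: (@bdd_between _ _ 0 1).
Qed.
End Correlation.

(** * Invariant means on the lattice from averages over rectangles *)

Section UltraLimit.
Local Open Scope ring_scope.

Lemma ultra_fmap (S T : Type) (f : S -> T) (U : set_system S) :
  UltraFilter U -> UltraFilter (f @ U).
Proof.
move=> UU; split; first exact: fmap_proper_filter.
move=> G GF UG; apply/seteqP; split=> [B GB|]; last exact: UG.
have [//|UnB] := in_ultra_setVsetC (f @^-1` B) UU.
have GnB : G (~` B) by exact: UG.
exfalso; have : G (B `&` ~` B) by exact: filterI.
by rewrite setICr; exact: filter_not_empty.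
Qed.

Lemma ultra_cvg (R : realType) (S : Type) (U : set_system S) (u : S -> R) (M : R) :
  UltraFilter U -> (forall k, `|u k| <= M) -> u k @[k --> U] --> lim (u k @[k --> U]).
Proof.
move=> UU uM; have := @segment_compact R (- M) M; rewrite compact_ultra.
move=> /(_ (u @ U) (ultra_fmap _ UU)) [|l [_ ul]].
  by rewrite /fmap/=; apply: filterE => k /=; rewrite in_itv/= -ler_norml uM.
by apply: cvgP; exact: ul.
Qed.

End UltraLimit.

Section RectangleMean.
Local Open Scope ring_scope.
Variable R : realType.
Implicit Types f : int * int -> R.

Definition rect_sum (a c : int) (p q : nat) f : R :=
  \sum_(i < p) \sum_(j < q) f (a + i%:Z, c + j%:Z).

Definition rect_avg (a c : int) (p q : nat) f : R :=
  rect_sum a c p q f / (p * q)%:R.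

Lemma rect_avgD a c p q f g :
  rect_avg a c p q (fun x => f x + g x) = rect_avg a c p q f + rect_avg a c p q g.
Proof.
rewrite /rect_avg -mulrDl; congr (_ / _); rewrite /rect_sum.
by under eq_bigr do rewrite big_split/=; rewrite big_split.
Qed.

Lemma rect_avgZ a c p q k f :
  rect_avg a c p q (fun x => k * f x) = k * rect_avg a c p q f.
Proof.
rewrite /rect_avg mulrA /rect_sum mulr_sumr; congr (_ / _).
by apply: eq_bigr => i _; rewrite mulr_sumr.
Qed.

Lemma le_rect_avg a c p q f g : (forall x, f x <= g x) ->
  rect_avg a c p q f <= rect_avg a c p q g.
Proof.
move=> fg; rewrite /rect_avg ler_wpM2r ?invr_ge0//.
by apply: ler_sum => i _; apply: ler_sum.
Qed.

Lemma rect_avg_cst a c p q k : (0 < p)%N -> (0 < q)%N ->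
  rect_avg a c p q (fun=> k) = k.
Proof.
move=> p0 q0; rewrite /rect_avg /rect_sum.
under eq_bigr do rewrite sumr_const card_ord.
rewrite sumr_const card_ord -mulrnA [(q * p)%N]mulnC -[_ *+ _]mulr_natr mulfK//.
by rewrite pnatr_eq0 -lt0n muln_gt0 p0.
Qed.

Lemma rect_avg_norm a c p q f M : (0 < p)%N -> (0 < q)%N ->
  (forall x, `|f x| <= M) -> `|rect_avg a c p q f| <= M.
Proof.
move=> p0 q0 fM; rewrite ler_norml -{1}(rect_avg_cst a c (- M) p0 q0).
rewrite -{2}(rect_avg_cst a c M p0 q0).
by apply/andP; split; apply: le_rect_avg => x; have := fM x; rewrite ler_norml => /andP[].
Qed.

Lemma rect_sum_tr a c p q f :
  rect_sum a c p q f = rect_sum c a q p (fun x => f (x.2, x.1)).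
Proof. by rewrite /rect_sum exchange_big. Qed.

(** Only the column that leaves the rectangle and the one that enters it
    contribute to the difference: the rest telescopes. *)
Lemma rect_avg_shift1 a c p q f M : (0 < p)%N -> (0 < q)%N ->
  (forall x, `|f x| <= M) ->
  `|rect_avg a c p q (fun x => f (x + (1, 0))) - rect_avg a c p q f| <= (2 * M) / p%:R.
Proof.
move=> p0 q0 fM; rewrite /rect_avg -mulrBl normrM normfV normr_nat.
rewrite ler_pdivrMr ?ltr0n ?muln_gt0 ?p0//.
have -> : 2 * M / p%:R * (p * q)%:R = \sum_(j < q) (2 * M).
  rewrite sumr_const card_ord natrM -mulr_natr; field.
  by rewrite pnatr_eq0 -lt0n.
suff -> : rect_sum a c p q (fun x => f (x + (1, 0))) - rect_sum a c p q f =
    \sum_(j < q) (f (a + p%:Z, c + j%:Z) - f (a, c + j%:Z)).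
  apply: le_trans (ler_norm_sum _ _ _) _; apply: ler_sum => j _.
  apply: le_trans (ler_normB _ _) _.
  by have := fM (a + p%:Z, c + j%:Z); have := fM (a, c + j%:Z); lra.
rewrite !(rect_sum_tr a c) /rect_sum -sumrB; apply: eq_bigr => j _ /=.
rewrite -sumrB -(big_mkord xpredT
  (fun i => f ((a + i%:Z, c + j%:Z) + (1, 0)) - f (a + i%:Z, c + j%:Z))).
under eq_bigr => i _.
  have -> : (a + i%:Z, c + j%:Z) + (1, 0) = (a + i.+1%:Z, c + j%:Z).
    by rewrite -[LHS]/(a + i%:Z + 1, c + j%:Z + 0) addr0 -addrA intS [1 + _]addrC.
  over.
by rewrite telescope_sumr// addr0.
Qed.

Lemma rect_avg_shift2 a c p q f M : (0 < p)%N -> (0 < q)%N ->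
  (forall x, `|f x| <= M) ->
  `|rect_avg a c p q (fun x => f (x + (0, 1))) - rect_avg a c p q f| <= (2 * M) / q%:R.
Proof.
move=> p0 q0 fM.
have := @rect_avg_shift1 c a q p (fun x => f (x.2, x.1)) M q0 p0 (fun x => fM _).
by rewrite /rect_avg mulnC !(rect_sum_tr c a).
Qed.

(** The mean is the limit of the averages along an ultrafilter.  It is invariant
    under the two unit vectors because the sides tend to infinity, and the
    vectors that leave it invariant form a subgroup. *)
Lemma invariant_mean (a c : nat -> int) (p q : nat -> nat) :
  (forall k, (k < p k)%N) -> (forall k, (k < q k)%N) ->
  exists L : (int * int -> R) -> R,
  [/\ is_mean L,
      forall v f, bdd f -> L (fun x => f (x + v)) = L f
    & forall f l, bdd f -> (forall e : R, 0 < e ->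
        \forall k \near \oo, l - e <= rect_avg (a k) (c k) (p k) (q k) f) ->
      l <= L f].
Proof.
move=> kp kq; have [U [UU ooU]] := ultraFilterLemma (eventually_filter).
have p0 k : (0 < p k)%N by rewrite (leq_ltn_trans _ (kp k)).
have q0 k : (0 < q k)%N by rewrite (leq_ltn_trans _ (kq k)).
pose E k f := rect_avg (a k) (c k) (p k) (q k) f.
pose L f : R := lim (E k f @[k --> U]).
have EL f : bdd f -> E k f @[k --> U] --> L f.
  by move=> [M fM]; apply: (@ultra_cvg _ _ _ _ M) => k; exact: rect_avg_norm.
have Lm : is_mean L.
  split=> [f g bf bg|k f bf|f g bf bg fg|].
  - apply: cvg_lim => //; rewrite /E; under eq_fun do rewrite rect_avgD.
    by apply: cvgD; exact: EL.
  - apply: cvg_lim => //; rewrite /E; under eq_fun do rewrite rect_avgZ.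
    by apply: cvgM; [exact: cvg_cst|exact: EL].
  - apply: ler_cvg_to (EL f bf) (EL g bg) _.
    by apply: filterE => k; exact: le_rect_avg.
  - apply: cvg_lim => //; rewrite /E; under eq_fun do rewrite rect_avg_cst//.
    exact: cvg_cst.
have small (M e : R) (s : nat -> nat) : 0 < e -> (forall k, (k < s k)%N) ->
    \forall k \near \oo, 2 * M / (s k)%:R <= e.
  move=> e0 ks; exists (Num.bound (2 * `|M| / e)) => // k /= bk.
  rewrite ler_pdivrMr ?ltr0n ?(leq_ltn_trans _ (ks k))//.
  have : 2 * `|M| / e <= (s k)%:R.
    apply: le_trans (ltW (archi_boundP _)) _; first by rewrite divr_ge0// ltW.
    by rewrite ler_nat (leq_trans bk)// ltnW.
  rewrite ler_pdivrMr// [e * _]mulrC; apply: le_trans.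
  by rewrite ler_wpM2l// ler_norm.
have near_inv f (v : int * int) : bdd f -> (forall e : R, 0 < e ->
    \forall k \near \oo, `|E k (fun x => f (x + v)) - E k f| <= e) ->
    L (fun x => f (x + v)) = L f.
  move=> bf Ev; have bfv : bdd (fun x => f (x + v)).
    by have [M fM] := bf; exists M => x; exact: fM.
  apply/eqP; rewrite -subr_eq0 -normr_le0; apply/ler_addgt0Pr => e e0.
  rewrite add0r -(meanB Lm)//.
  set d := (X in L X); have bd : bdd d by exact: bddB.
  have ELd : `|E k d| @[k --> U] --> `|L d| by apply: cvg_norm; exact: EL.
  refine (cvgr_to_le ELd _); apply: ooU; move: (Ev _ e0); apply: filterS => k.
  congr (`|_| <= _); rewrite /E.
  rewrite -[X in _ = X](addrK (rect_avg (a k) (c k) (p k) (q k) f)) -rect_avgD.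
  by under [X in _ = rect_avg _ _ _ _ X - _]eq_fun do rewrite subrK.
pose inv v := forall f, bdd f -> L (fun x => f (x + v)) = L f.
have inv0 : inv 0 by move=> f _; under eq_fun do rewrite addr0.
have invD v w : inv v -> inv w -> inv (v + w).
  move=> iv iw f [M fM]; rewrite -(iv f); last by exists M.
  rewrite -(iw (fun x => f (x + v))); last by exists M => x; exact: fM.
  by congr L; apply: funext => x; rewrite addrA addrAC.
have invN v : inv v -> inv (- v).
  move=> iv f [M fM]; rewrite -iv; last by exists M => x; exact: fM.
  by under eq_fun do rewrite addrK.
have inv_mul v (n : int) : inv v -> inv (v *~ n).
  have inv_nat m : inv v -> inv (v *+ m).
    by move=> iv; elim: m => [|m IHm]; rewrite ?mulr0n// mulrS; exact: invD.
  by move=> iv; case: n => m; [exact: inv_nat|apply: invN; exact: inv_nat].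
have inv1 : inv (1, 0).
  move=> f [M fM]; apply: near_inv; first by exists M.
  move=> e e0; have := small M e p e0 kp; apply: filterS => k.
  by apply: le_trans; exact: rect_avg_shift1.
have inv2 : inv (0, 1).
  move=> f [M fM]; apply: near_inv; first by exists M.
  move=> e e0; have := small M e q e0 kq; apply: filterS => k.
  by apply: le_trans; exact: rect_avg_shift2.
exists L; split=> // [[m n]|f l bf lf].
  have -> : (m, n) = ((1, 0) : int * int) *~ m + ((0, 1) : int * int) *~ n.
    have fstMz (x : int * int) k : (x *~ k).1 = x.1 *~ k by exact: (raddfMz fst).
    have sndMz (x : int * int) k : (x *~ k).2 = x.2 *~ k by exact: (raddfMz snd).
    apply/eqP; rewrite xpair_eqE /= !fstMz !sndMz /= !intz !mul0rz.
    by rewrite addr0 add0r !eqxx.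
  by apply: invD; exact: inv_mul.
apply/ler_addgt0Pr => e e0; rewrite -lerBlDr.
by apply: (cvgr_to_ge (EL f bf)); apply: ooU; exact: lf.
Qed.

End RectangleMean.

(** * Upper Banach density as a mean *)

Section UpperLimits.
Variable R : realType.

Lemma limn_esup_le (u : (\bar R)^nat) (c : \bar R) :
  (\forall n \near \oo, (u n <= c)%E) -> (limn_esup u <= c)%E.
Proof.
move=> [m _ um]; rewrite limn_esup_lim; apply: lime_le; first exact: is_cvg_esups.
exists m => // n /= mn; apply: ub_ereal_sup => _ [k /= nk <-].
by apply: um; exact: leq_trans nk.
Qed.

Lemma limn_esup_ge (u : (\bar R)^nat) (c : \bar R) :
  (forall e : R, (0 < e)%R -> forall m, exists2 n, (m <= n)%N & (c <= u n + e%:E)%E) ->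
  (c <= limn_esup u)%E.
Proof.
move=> cu; rewrite limn_esup_lim; apply: lime_ge; first exact: is_cvg_esups.
apply: nearW => m; apply/lee_addgt0Pr => e e0.
have [n mn cn] := cu e e0 m; apply: (le_trans cn); apply: leeD => //.
by apply: ereal_sup_ubound; exists n.
Qed.

End UpperLimits.

Section RectangleDensity.
Local Open Scope ring_scope.
Variable R : realType.

Lemma set_card_setI_seq (T : choiceType) (A : set T) (s : seq T) : uniq s ->
  set_card (A `&` [set` s]) = count (mem A) s.
Proof.
move=> us; have -> : A `&` [set` s] = [set` [seq x <- s | x \in A]].
  apply/seteqP; split=> x /=; rewrite mem_filter.
    by move=> [Ax xs]; rewrite xs mem_set.
  by move=> /andP[/set_mem].
rewrite -size_filter /set_card; apply: perm_size.
apply: uniq_perm; rewrite ?filter_uniq// => x.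
by rewrite in_fset_set//= mem_setE.
Qed.

(** The corners of the rectangle are included, so its sides contain [p.+1] and
    [q.+1] lattice points. *)
Lemma rel_density_rect (A : set (int * int)) (a c : int) (p q : nat) :
  rel_density R A (lattice_rect a (a + p%:Z) c (c + q%:Z)) =
  rect_avg a c p.+1 q.+1 (\1_A : int * int -> R).
Proof.
pose s := [seq (a + i%:Z, c + j%:Z) | i <- iota 0 p.+1, j <- iota 0 q.+1].
have us : uniq s.
  apply: allpairs_uniq; rewrite ?iota_uniq// => -[i j] [i' j'] _ _ /= [].
  by move=> /addrI[->] /addrI[->].
have Q_s : lattice_rect a (a + p%:Z) c (c + q%:Z) = [set` s].
  apply/seteqP; split=> [[x y]|_ /allpairsP[[i j] [+ + ->]]].
    rewrite /lattice_rect /= !in_itv/= => -[/andP[ax xp] /andP[cy yq]].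
    apply/allpairsP; exists (`|x - a|%N, `|y - c|%N); rewrite !mem_iota /=.
    by split; [lia|lia|congr pair; lia].
  by rewrite !mem_iota /lattice_rect /= !in_itv/=; lia.
rewrite /rel_density /rect_avg Q_s -[X in _ / (set_card X)%:R]setTI.
rewrite !set_card_setI_seq// [count (mem setT) s](eq_count (a2 := xpredT)); last first.
  by move=> x; apply: (@mem_set _ setT).
rewrite count_predT size_allpairs !size_iota; congr (_ / _).
rewrite -sum1_count natr_sum big_mkcond big_allpairs_dep /rect_sum.
rewrite -[in LHS](subn0 p.+1) -/(index_iota 0 p.+1) big_mkord.
apply: eq_bigr => i _; rewrite -[in LHS](subn0 q.+1) -/(index_iota 0 q.+1) big_mkord.
by apply: eq_bigr => j _; rewrite indicE; case: ifP => h; rewrite [_ \in A]h.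
Qed.

(** Both the finiteness of the density and, by contraposition, the existence of
    large rectangles in which [A] is dense come from this bound. *)
Lemma upper_banach_density_le (A : set (int * int)) (k : nat) (l : R) :
  (forall a c p q, (k < p)%N -> (k < q)%N ->
    rect_avg a c p q (\1_A : int * int -> R) <= l) ->
  (upper_banach_density R A <= l%:E)%E.
Proof.
move=> Al; apply: ub_ereal_sup => _ [Q [a [b [c [d [QE ab cd]]]]] <-].
apply: limn_esup_le.
have big (u : nat -> int) : (u N)%:~R @[N --> \oo] --> (+oo : set_system R) ->
    \forall N \near \oo, (k%:Z <= u N).
  move=> /cvgryPge /(_ k%:R); apply: filterS => N.
  by rewrite -[k%:R]/(k%:Z%:~R) ler_int.
near=> N; have kab : k%:Z <= b N - a N by near: N; exact: big.
have kcd : k%:Z <= d N - c N by near: N; exact: big.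
rewrite QE lee_fin.
have -> : b N = a N + `|b N - a N|%N%:Z by lia.
have -> : d N = c N + `|d N - c N|%N%:Z by lia.
by rewrite rel_density_rect; apply: Al; lia.
Unshelve. all: by end_near. Qed.

(** Rectangles of sides larger than [k] with density at least
    [r - k.+1%:R^-1] exist for every [k]; their averages define the mean. *)
Lemma density_invariant_mean (A : set (int * int)) :
  (0 < upper_banach_density R A)%E ->
  exists (r : R) (L : (int * int -> R) -> R),
  [/\ upper_banach_density R A = r%:E, is_mean L,
      forall v f, bdd f -> L (fun x => f (x + v)) = L f
    & r <= L (\1_A : int * int -> R)].
Proof.
set F : int * int -> R := \1_A; move=> A_gt0.
have F01 x : 0 <= F x <= 1 by rewrite /F indicE; case: (_ \in _); rewrite lexx ler01.
have A_le1 : (upper_banach_density R A <= 1%:E)%E.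
  apply: (@upper_banach_density_le _ 0) => a c p q p0 q0.
  rewrite -[leRHS](rect_avg_cst a c _ p0 q0); apply: le_rect_avg => x.
  by have /andP[] := F01 x.
exists (fine (upper_banach_density R A)); set r := fine _.
have Ar : upper_banach_density R A = r%:E.
  rewrite fineK// fin_numE; apply/andP; split.
    by rewrite gt_eqF// (lt_trans _ A_gt0)// ltNy0.
  by rewrite lt_eqF// (le_lt_trans A_le1)// ltry.
have rect k : exists z : int * int * (nat * nat),
    [/\ (k < z.2.1)%N, (k < z.2.2)%N &
        r - k.+1%:R^-1 <= rect_avg z.1.1 z.1.2 z.2.1 z.2.2 F].
  apply: contrapT => nz.
  have : (upper_banach_density R A <= (r - k.+1%:R^-1)%:E)%E.
    apply: (@upper_banach_density_le _ k) => a c p q kp kq.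
    rewrite leNgt; apply/negP => h; apply: nz; exists ((a, c), (p, q)).
    by split => //; exact: ltW.
  by rewrite Ar lee_fin lerBrDr gerDl leNgt invr_gt0 ltr0n.
have [z /all_and3[zp zq zF]] := choice rect.
have [L [Lm Linv LF]] := @invariant_mean R (fun k => (z k).1.1) (fun k => (z k).1.2) _ _ zp zq.
exists L; split=> //; apply: LF; first exact: bdd_between F01.
move=> e e0; exists (Num.bound e^-1) => // k /= ek.
apply: le_trans (zF k); rewrite lerD2l lerN2 invf_ple ?posrE ?ltr0n//.
apply: le_trans (ltW (archi_boundP _)) _; first by rewrite invr_ge0 ltW.
by rewrite ler_nat (leq_trans ek).
Qed.

End RectangleDensity.

(** * The sets of return times and their limits *)

Section ReturnTimes.
Local Open Scope ring_scope.
Variable R : realType.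

Definition log_avg (B : set int) (N : nat) : R :=
  (\sum_(1 <= n < N.+1) \1_B n%:Z / n%:R) / harm R N.

Lemma log_avg01 B N : 0 <= log_avg B N <= 1.
Proof.
have s01 : 0 <= \sum_(1 <= n < N.+1) (\1_B n%:Z / n%:R : R) <= harm R N.
  apply/andP; split.
    by apply: sumr_ge0 => n _; rewrite divr_ge0// indicE.
  apply: ler_sum => n _; rewrite -[leRHS]mul1r ler_wpM2r ?invr_ge0//.
have /andP[s0 s1] := s01; rewrite /log_avg divr_ge0 ?harm_ge0//=.
have [->|h0] := eqVneq (harm R N) 0; first by rewrite invr0 mulr0.
by rewrite ler_pdivrMr ?mul1r// lt_def h0 harm_ge0.
Qed.

(** Replacing the harmonic number by [ln N], which is smaller, only increases the
    averages; the values [N <= 1], where [ln N] is not positive, are avoided by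
    taking [j >= 2]. *)
Lemma upper_log_density_ge (B : set int) (beta : R) :
  (forall j, exists2 N, (j <= N)%N & beta - 2^-1 ^+ j <= log_avg B N) ->
  (beta%:E <= upper_log_density R B)%E.
Proof.
move=> HB; apply: limn_esup_ge => e e0 m.
pose j := maxn m (maxn 2 (Num.bound e^-1)).
have [N jN BN] := HB j; exists N; first by rewrite (leq_trans _ jN)// leq_maxl.
have N1 : (1 < N)%N by rewrite (leq_trans _ jN)// leq_max leq_max ltnSn orbT.
have ej : 2^-1 ^+ j <= e.
  rewrite exprVn invf_ple ?posrE ?exprn_gt0// ltW// upper_nthrootP//.
  by rewrite /j !leq_max leqnn !orbT.
rewrite -EFinD lee_fin -lerBlDr; apply: le_trans (_ : log_avg B N <= _).
  by apply: le_trans BN; rewrite lerD2l lerN2.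
rewrite /log_avg mulrC ler_wpM2r//.
  by apply: sumr_ge0 => n _; rewrite divr_ge0// indicE.
have lnN : 0 < ln (N%:R : R) by rewrite ln_gt0// ltr1n.
rewrite lef_pV2 ?posrE ?harm_gt0//; last by rewrite ltnW.
apply: le_trans (lnS_le_harm R N); rewrite ler_ln ?posrE ?ltr0n ?ler_nat//.
by rewrite ltnW.
Qed.

Variable A : set (int * int).

(** A point [x + (b, 0)] of [A] and a point [x - (0, b')] of [A] differ by
    [(b, b')]; this is why the two coordinates carry opposite signs. *)
Definition return_times (x : int * int) : set int :=
  [set n | A (x + (n, 0)) /\ A (x - (0, n))].

(** Translating by [(0, - n)] turns the mean of the event
    [n \in return_times x] into the correlation of the indicator of [A] at lag
    [(n, n)]. *)
Lemma mean_log_avg (L : (int * int -> R) -> R) : is_mean L ->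
  (forall v f, bdd f -> L (fun x => f (x + v)) = L f) ->
  forall N, (0 < N)%N ->
  L \1_A ^+ 2 - 2 / harm R N <= L (fun x => log_avg (return_times x) N).
Proof.
move=> Lm Linv N N0; pose phi : int * int -> R := \1_A.
have phi01 x : 0 <= phi x <= 1.
  by rewrite /phi indicE; case: (_ \in _); rewrite lexx ler01.
have bphi v : bdd (fun x => phi (x + v)) by apply: (@bdd_between _ _ 0 1).
have h0 := @harm_gt0 R N N0.
have bret n : bdd (fun x => \1_(return_times x) n : R).
  by apply: (@bdd_between _ _ 0 1) => x; rewrite indicE; case: (_ \in _);
    rewrite lexx ler01.
have Lret (n : nat) : L (fun x => \1_(return_times x) n%:Z) =
    L (fun x => phi x * phi (x + ((1, 1) : int * int) *+ n)).
  rewrite -[RHS](Linv (0, - n%:Z)); last first.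
    by apply: bddM => //; exact: (@bdd_between _ _ 0 1).
  congr L; apply: funext => x; rewrite /phi !indicE -natrM mulnb; congr (_%:R).
  have -> : ((1, 1) : int * int) *+ n = (n%:Z, n%:Z).
    elim: n => // n IHn; rewrite mulrS IHn.
    by rewrite -[LHS]/(1 + n%:Z, 1 + n%:Z) -intS.
  have -> : x + (0, - n%:Z) + (n%:Z, n%:Z) = x + (n%:Z, 0).
    case: x => a b; rewrite -[LHS]/(a + 0 + n%:Z, b - n%:Z + n%:Z).
    by rewrite subrK addr0 -[RHS]/(a + n%:Z, b + 0) addr0.
  have -> : x + (0, - n%:Z) = x - (0, n%:Z) by [].
  congr nat_of_bool; apply/idP/andP => [/set_mem[Ax1 Ax2]|[/set_mem Ax2 /set_mem Ax1]].
    by split; exact: mem_set.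
  by apply: mem_set; split.
have -> : L (fun x => log_avg (return_times x) N) = (harm R N)^-1 *
    \sum_(1 <= n < N.+1) L (fun x => phi x * phi (x + ((1, 1) : int * int) *+ n)) / n%:R.
  have bterm (n : nat) : bdd (fun x => n%:R^-1 * \1_(return_times x) n%:Z : R).
    by apply: bddZ; exact: bret.
  transitivity (L (fun x => (harm R N)^-1 * \sum_(1 <= n < N.+1)
      n%:R^-1 * \1_(return_times x) n%:Z)).
    congr L; apply: funext => x; rewrite /log_avg mulrC; congr (_ * _).
    by apply: eq_bigr => n _; rewrite mulrC.
  rewrite (meanZ Lm); last exact: bdd_sum.
  rewrite (mean_sum Lm)//; congr (_ * _); apply: eq_bigr => n _.
  by rewrite (meanZ Lm)// Lret mulrC.
have hn0 : harm R N != 0 by rewrite gt_eqF.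
rewrite -[leLHS](mulKf hn0) ler_pM2l ?invr_gt0//.
have := log_correlation_ge Lm Linv (1, 1) phi01 N; apply: le_trans.
by rewrite mulrBr [harm R N * (2 / _)]mulrCA mulfV// mulr1 [harm R N * _]mulrC.
Qed.

(** A pair of elements of the limit set lies in a single set of return times,
    since two members of the filter meet. *)
Lemma difference_set_limit (U : set_system nat) (x : nat -> int * int) :
  ProperFilter U -> let B := [set n | U [set k | return_times (x k) n]] in
  B `*` B `<=` difference_set A.
Proof.
move=> UF B [b b'] [/= Bb Bb'].
have [k [[Ab _] [_ Ab']]] := filter_ex (filterI Bb Bb').
exists (x k + (b, 0)) => //; exists (x k - (0, b')) => //.
case: (x k) => s t; rewrite -[LHS]/(s + b - (s - 0), t + 0 - (t - b')).
by congr pair; lia.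
Qed.

(** An ultrafilter decides each condition [C k n], and finitely many such
    decisions hold at once; so limits along it may be tested on initial
    segments. *)
Lemma ultra_agree (U : set_system nat) (C : nat -> set int) (M : nat) :
  UltraFilter U -> let B := [set n | U [set k | C k n]] in
  \forall k \near U, forall n, (n < M)%N -> (B n%:Z <-> C k n%:Z).
Proof.
move=> UU B; elim: M => [|M IHM]; first by apply: nearW => k n.
have UM : \forall k \near U, (B M%:Z <-> C k M%:Z).
  have [UC|UnC] := in_ultra_setVsetC [set k | C k M%:Z] UU.
    by apply: filterS (UC) => k Ck; split=> // _; exact: UC.
  apply: filterS (UnC) => k nCk; split=> // BM; exfalso.
  have : U ([set k | C k M%:Z] `&` ~` [set k | C k M%:Z]) by exact: filterI.
  by rewrite setICr; exact: filter_not_empty.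
apply: filterS2 IHM UM => k IH kM n; rewrite ltnS leq_eqVlt => /predU1P[->//|].
exact: IH.
Qed.

End ReturnTimes.

Local Open Scope ereal_scope.

Theorem proposition1p23 (R : realType) (A : set (int * int)) :
  0 < upper_banach_density R A ->
  exists B : set int,
    upper_banach_density R A ^+ 2 <= upper_log_density R B /\
    B `*` B `<=` difference_set A.
Proof.
move=> A_gt0; have [r [L [Ar Lm Linv rL]]] := density_invariant_mean A_gt0.
have r_ge0 : (0 <= r)%R by rewrite -lee_fin -Ar ltW.
pose beta : R := (L \1_A ^+ 2)%R.
have [j N|e j e0|K HK] :=
    @simultaneous_windows R _ L Lm (fun N x => log_avg R (return_times A x) N) _ beta.
- exact: log_avg01.
- have [N jN eN] := harm_unbounded (2 / e)%R (maxn j 1).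
  have N0 : (0 < N)%N by rewrite (leq_trans _ jN)// leq_maxr.
  exists N; first by rewrite (leq_trans _ jN)// leq_maxl.
  apply: le_trans (mean_log_avg A Lm Linv N0); rewrite lerD2l lerN2.
  by rewrite ler_pdivrMr ?harm_gt0// mulrC -ler_pdivrMr.
have [x Hx] := choice HK.
have [U [UU ooU]] := ultraFilterLemma eventually_filter.
exists [set n | U [set k | return_times A (x k) n]]; split; last first.
  exact: difference_set_limit.
rewrite Ar -EFin_expe; apply: (@le_trans _ _ beta%:E).
  by rewrite lee_fin ler_pXn2r ?nnegrE// (le_trans r_ge0).
apply: upper_log_density_ge => j.
have [k [agree jk]] := filter_ex (filterI
  (ultra_agree (fun k => return_times A (x k)) (K j) UU) (ooU _ (nbhs_infty_gt j))).
have [N /andP[jN NK] bN] := Hx k j jk; exists N => //.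
set B := [set n | _] in agree *.
suff -> : log_avg R B N = log_avg R (return_times A (x k)) N by [].
congr (_ / _)%R; apply: eq_big_nat => n /andP[_ nN]; congr (_ / _)%R.
have nK : (n < K j)%N := leq_trans nN NK.
by rewrite !indicE; congr ((nat_of_bool _)%:R)%R; apply/idP/idP => /set_mem h; apply: mem_set;
  exact/(agree n nK).
Qed.
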